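(* Let $f\colon\mathbb{R}^2\to\mathbb{R}$ and $\langle x,y\rangle\in\mathbb{R}^2$. If $f$ is very feebly continuous at $\langle x,y\rangle$, then $f$ is two-feebly continuous at $\langle x,y\rangle$; likewise, if $f$ is reverse very feebly continuous at $\langle x,y\rangle$, then $f$ is two-feebly continuous at $\langle x,y\rangle$. The converse implications need not hold: there exist a function $\mathbb{R}^2\to\mathbb{R}$ and a point at which it is two-feebly continuous but not very feebly continuous, and likewise there exist a function $\mathbb{R}^2\to\mathbb{R}$ and a point at which it is two-feebly continuous but not reverse very feebly continuous.
   Context: Notation: $x_n\searrow x$ means that $(x_n)$ is a strictly decreasing sequence of reals converging to $x$. Let $f\colon\mathbb{R}^2\to\mathbb{R}$. $f$ is very feebly continuous at $\langle x,y\rangle$ if there exist a sequence $x_n\searrow x$ and, for each $n\in\mathbb{N}$, a sequence $y^{(n)}_m\searrow y$ (as $m\to\infty$) such that $\lim_{n\to\infty}\lim_{m\to\infty}f(x_n,y^{(n)}_m)=f(x,y)$. $f$ is reverse very feebly continuous at $\langle x,y\rangle$ if the same holds with the roles of the coordinates exchanged: there exist a sequence $y_m\searrow y$ and, for each $m\in\mathbb{N}$, a sequence $x^{(m)}_n\searrow x$ (as $n\to\infty$) such that $\lim_{m\to\infty}\lim_{n\to\infty}f(x^{(m)}_n,y_m)=f(x,y)$. (In each case the inner limits exist in $\mathbb{R}$, and the outer limit exists.) $f$ is two-feebly continuous at $\langle x,y\rangle$ if there exist sequences $x_n\searrow x$ and $y_n\searrow y$ such that $\lim_{n\to\infty}f(x_n,y_n)=f(x,y)$.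 *)

(* Defs.v *)
From Stdlib Require Import Reals.
Open Scope R_scope.

Definition strictly_decreases_to (u : nat -> R) (x : R) : Prop :=
  (forall n : nat, u (S n) < u n) /\ Un_cv u x.

(* In the iterated limits, [l] is the sequence of inner limits; stating them
   through [Un_cv] makes their existence in [R] part of the definition. *)
Definition very_feebly_continuous (f : R * R -> R) (x y : R) : Prop :=
  exists (xs : nat -> R) (ys : nat -> nat -> R) (l : nat -> R),
    strictly_decreases_to xs x /\
    (forall n : nat, strictly_decreases_to (ys n) y) /\
    (forall n : nat, Un_cv (fun m : nat => f (xs n, ys n m)) (l n)) /\
    Un_cv l (f (x, y)).

Definition reverse_very_feebly_continuous (f : R * R -> R) (x y : R) : Prop :=
  exists (ys : nat -> R) (xs : nat -> nat -> R) (l : nat -> R),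
    strictly_decreases_to ys y /\
    (forall m : nat, strictly_decreases_to (xs m) x) /\
    (forall m : nat, Un_cv (fun n : nat => f (xs m n, ys m)) (l m)) /\
    Un_cv l (f (x, y)).

Definition two_feebly_continuous (f : R * R -> R) (x y : R) : Prop :=
  exists xs ys : nat -> R,
    strictly_decreases_to xs x /\
    strictly_decreases_to ys y /\
    Un_cv (fun n : nat => f (xs n, ys n)) (f (x, y)).

(* Main.v *)
Require Import Defs.
From Stdlib Require Import Reals Lra Lia IndefiniteDescription.
Open Scope R_scope.

(** For the implications, a point [(xs n, ys n m)] with [m] large has its value
    close to the inner limit [l n], so choosing one such [m] for each [n] gives
    points whose values converge to [f (x, y)].  The chosen second coordinates
    must also decrease strictly to [y]; since each row [ys n] converges to [y]
    from strictly above, the [n]-th choice can be pushed below the previous one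
    and within [1 / (n + 1)] of [y] ([decreasing_diagonal]).  Exchanging the
    coordinates reduces the reverse notion to the direct one.

    For the failure of the converses, the indicator of the complement of the
    diagonal works at the origin: it vanishes along the diagonal, whereas on a
    vertical line [x = a] with [a > 0] it is [1] near the horizontal axis.  All
    inner limits are then [1], although the value at the origin is [0].  This
    function is symmetric, hence serves for both notions. *)

Lemma strictly_decreases_to_lt (u : nat -> R) (x : R) :
  strictly_decreases_to u x -> forall n : nat, x < u n.
Proof.
  intros [Hdec Hcv] n.
  assert (Hmon : Un_decreasing u) by (intro k; apply Rlt_le, Hdec).
  pose proof (decreasing_ineq u x Hmon Hcv (S n)) as Hle.
  specialize (Hdec n). lra.
Qed.

Lemma inv_INR_S_cv_0 : Un_cv (fun n : nat => / INR (S n)) 0.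
Proof.
  intros eps Heps.
  destruct (archimed_cor1 eps Heps) as [N [HN HN0]].
  exists N. intros n Hn.
  assert (0 < INR N) by (apply lt_0_INR; lia).
  assert (INR N <= INR (S n)) by (apply le_INR; lia).
  assert (/ INR (S n) <= / INR N) by (apply Rinv_le_contravar; assumption).
  assert (0 < / INR (S n)) by (apply Rinv_0_lt_compat; lra).
  unfold Rdist. rewrite Rminus_0_r, Rabs_pos_eq; lra.
Qed.

Lemma Un_cv_of_close (u l : nat -> R) (a : R) :
  (forall n : nat, Rabs (u n - l n) < / INR (S n)) -> Un_cv l a -> Un_cv u a.
Proof.
  intros Hclose Hl eps Heps.
  destruct (Hl (eps / 2)) as [N1 H1]; [lra|].
  destruct (inv_INR_S_cv_0 (eps / 2)) as [N2 H2]; [lra|].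
  exists (N1 + N2)%nat. intros n Hn.
  specialize (H1 n ltac:(lia)). specialize (H2 n ltac:(lia)).
  specialize (Hclose n). unfold Rdist in *.
  apply Rabs_def2 in H1, H2, Hclose.
  apply Rabs_def1; lra.
Qed.

Lemma inv_INR_S_strictly_decreases :
  strictly_decreases_to (fun n : nat => / INR (S n)) 0.
Proof.
  split; [|apply inv_INR_S_cv_0].
  intro n. apply Rinv_lt_contravar.
  - apply Rmult_lt_0_compat; apply lt_0_INR; lia.
  - apply lt_INR; lia.
Qed.

(** The bound [b] stands for the previously chosen point, so that iterating this
    lemma yields a strictly decreasing sequence. *)
Lemma close_value_below (g : R -> R) (u : nat -> R) (y l b eps : R) :
  strictly_decreases_to u y -> Un_cv (fun m : nat => g (u m)) l ->
  y < b -> 0 < eps ->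
  exists z : R, y < z < b /\ Rabs (z - y) < eps /\ Rabs (g z - l) < eps.
Proof.
  intros Hu Hg Hb Heps.
  pose proof (strictly_decreases_to_lt u y Hu) as Hgt.
  destruct Hu as [_ Hcv].
  destruct (Hcv (b - y)) as [N1 H1]; [lra|].
  destruct (Hcv eps Heps) as [N2 H2].
  destruct (Hg eps Heps) as [N3 H3].
  set (m := (N1 + N2 + N3)%nat).
  specialize (H1 m ltac:(lia)). specialize (H2 m ltac:(lia)).
  specialize (H3 m ltac:(lia)). specialize (Hgt m).
  unfold Rdist in *. apply Rabs_def2 in H1.
  exists (u m). repeat split; [lra | lra | exact H2 | exact H3].
Qed.

(** A diagonal argument: any [m] large enough will do in the [n]-th row, which
    leaves enough freedom to make the selected points decrease strictly. *)
Lemma decreasing_diagonal (g : nat -> R -> R) (ys : nat -> nat -> R)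
    (l : nat -> R) (y : R) :
  (forall n : nat, strictly_decreases_to (ys n) y) ->
  (forall n : nat, Un_cv (fun m : nat => g n (ys n m)) (l n)) ->
  exists zs : nat -> R,
    strictly_decreases_to zs y /\
    forall n : nat, Rabs (g n (zs n) - l n) < / INR (S n).
Proof.
  intros Hys Hg.
  assert (Hstep : forall p : nat * R, exists z : R, y < snd p ->
    y < z < snd p /\ Rabs (z - y) < / INR (S (fst p)) /\
    Rabs (g (fst p) z - l (fst p)) < / INR (S (fst p))).
  { intros [n b]; cbn [fst snd].
    destruct (Rlt_dec y b) as [Hb | Hb]; [|exists 0; contradiction].
    destruct (close_value_below (g n) (ys n) y (l n) b (/ INR (S n)))
      as [z Hz]; auto.
    - apply Rinv_0_lt_compat, lt_0_INR; lia.
    - exists z; auto. }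
  apply functional_choice in Hstep. destruct Hstep as [next Hnext].
  set (zs := fix zs (n : nat) : R :=
    match n with
    | O => next (O, y + 1)
    | S k => next (S k, zs k)
    end).
  assert (Hgt : forall n : nat, y < zs n).
  { induction n as [|n IH]; cbn.
    - apply (Hnext (O, y + 1)); cbn; lra.
    - apply (Hnext (S n, zs n)); exact IH. }
  assert (Hclose : forall n : nat, Rabs (zs n - y) < / INR (S n) /\
    Rabs (g n (zs n) - l n) < / INR (S n)).
  { intros [|n].
    - apply (Hnext (O, y + 1)); cbn; lra.
    - apply (Hnext (S n, zs n)); apply Hgt. }
  exists zs. split; [split|].
  - intro n. apply (Hnext (S n, zs n)); apply Hgt.
  - apply Un_cv_of_close with (l := fun _ => y).
    + intro n; apply Hclose.
    + intros eps Heps. exists O. intros n _. rewrite Rdist_eq. exact Heps.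
  - intro n; apply Hclose.
Qed.

Lemma very_feebly_two_feebly (f : R * R -> R) (x y : R) :
  very_feebly_continuous f x y -> two_feebly_continuous f x y.
Proof.
  intros (xs & ys & l & Hxs & Hys & Hin & Hout).
  destruct (decreasing_diagonal (fun n z => f (xs n, z)) ys l y Hys Hin)
    as (zs & Hzs & Hclose).
  exists xs, zs. repeat split; try apply Hxs; try apply Hzs.
  exact (Un_cv_of_close _ l _ Hclose Hout).
Qed.

Definition swap_arguments (f : R * R -> R) (p : R * R) : R := f (snd p, fst p).

Lemma reverse_very_feebly_swap (f : R * R -> R) (x y : R) :
  reverse_very_feebly_continuous f x y ->
  very_feebly_continuous (swap_arguments f) y x.
Proof.
  intro H; exact H.
Qed.

Lemma two_feebly_swap (f : R * R -> R) (x y : R) :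
  two_feebly_continuous (swap_arguments f) y x -> two_feebly_continuous f x y.
Proof.
  intros (ys & xs & Hys & Hxs & Hcv). exists xs, ys. auto.
Qed.

Definition off_diagonal (p : R * R) : R :=
  if Req_dec_T (fst p) (snd p) then 0 else 1.

Lemma off_diagonal_eq (a : R) : off_diagonal (a, a) = 0.
Proof.
  unfold off_diagonal; cbn. destruct (Req_dec_T a a); congruence.
Qed.

Lemma off_diagonal_neq (a b : R) : a <> b -> off_diagonal (a, b) = 1.
Proof.
  intro H. unfold off_diagonal; cbn. destruct (Req_dec_T a b); congruence.
Qed.

Lemma off_diagonal_sym (a b : R) : off_diagonal (a, b) = off_diagonal (b, a).
Proof.
  destruct (Req_dec_T a b) as [-> | H]; [reflexivity|].
  rewrite !off_diagonal_neq; auto.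
Qed.

Lemma off_diagonal_two_feebly : two_feebly_continuous off_diagonal 0 0.
Proof.
  exists (fun n => / INR (S n)), (fun n => / INR (S n)).
  split; [|split]; try apply inv_INR_S_strictly_decreases.
  intros eps Heps. exists O. intros n _.
  rewrite !off_diagonal_eq, Rdist_eq. exact Heps.
Qed.

Lemma off_diagonal_not_very_feebly :
  ~ very_feebly_continuous off_diagonal 0 0.
Proof.
  intros (xs & ys & l & Hxs & Hys & Hin & Hout).
  rewrite off_diagonal_eq in Hout.
  assert (Hl : forall n, l n = 1).
  { intro n. apply (UL_sequence _ _ _ (Hin n)).
    intros eps Heps.
    pose proof (strictly_decreases_to_lt xs 0 Hxs n) as Hpos.
    destruct (Hys n) as [_ Hcv].
    (* Past this rank the row lies strictly below the diagonal. *)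
    destruct (Hcv (xs n) Hpos) as [N HN].
    exists N. intros m Hm. specialize (HN m Hm).
    unfold Rdist in HN. apply Rabs_def2 in HN.
    rewrite off_diagonal_neq by lra. rewrite Rdist_eq. exact Heps. }
  destruct (Hout 1) as [N HN]; [lra|].
  specialize (HN N (le_n N)). rewrite Hl in HN.
  unfold Rdist in HN. apply Rabs_def2 in HN. lra.
Qed.

Lemma off_diagonal_not_reverse_very_feebly :
  ~ reverse_very_feebly_continuous off_diagonal 0 0.
Proof.
  intros (ys & xs & l & Hys & Hxs & Hin & Hout).
  apply off_diagonal_not_very_feebly.
  exists ys, xs, l. repeat split; try apply Hys; try apply Hxs; auto.
  intros n eps Heps. destruct (Hin n eps Heps) as [N HN].
  exists N. intros m Hm. rewrite off_diagonal_sym. exact (HN m Hm).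
Qed.

Theorem proposition11 :
  (forall (f : R * R -> R) (x y : R),
     (very_feebly_continuous f x y -> two_feebly_continuous f x y) /\
     (reverse_very_feebly_continuous f x y -> two_feebly_continuous f x y)) /\
  (exists (f : R * R -> R) (x y : R),
     two_feebly_continuous f x y /\ ~ very_feebly_continuous f x y) /\
  (exists (f : R * R -> R) (x y : R),
     two_feebly_continuous f x y /\ ~ reverse_very_feebly_continuous f x y).
Proof.
  split; [|split].
  - intros f x y. split; [apply very_feebly_two_feebly|].
    intro H. apply two_feebly_swap, very_feebly_two_feebly.
    exact (reverse_very_feebly_swap f x y H).
  - exists off_diagonal, 0, 0.
    split; [apply off_diagonal_two_feebly | apply off_diagonal_not_very_feebly].
  - exists off_diagonal, 0, 0. split;
      [apply off_diagonal_two_feebly | apply off_diagonal_not_reverse_very_feebly].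
Qed.
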